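(* Consider the Allen–Cahn nonlinearity $f(\phi)=\phi-\phi^3$. Let $k\in\{1,2,3,4\}$ and let $\phi^{n+1,(m)}$ be the $m$-th algorithmic iterate produced by the sBDF$k$ fixed-point algorithm (defined in the context) at time level $t_{n+1}$. Define the augmented energy $$\mathcal E_k^m:=E_h[\phi^{n+1,(m)}]+\mathbb H_k(\phi^{n+1,(m)}).$$ Then for any time step $\Delta t>0$, $\mathcal E_k^m$ is non-increasing in the iteration index $m$, i.e. $\mathcal E_k^{m+1}\le\mathcal E_k^m$ for all $m\ge 0$. Upon convergence of the iteration ($\phi^{n+1}=\lim_{m\to\infty}\phi^{n+1,(m)}$), the scheme satisfies the energy decay law $$E_h[\phi^{n+1}]+\mathbb H_k(\phi^{n+1})\le E_h[\phi^n]+\mathbb H_k(\phi^n).$$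
   Context: Let $\alpha>0$, $h>0$, $\Delta t>0$, $f(s)=s-s^3$, $F(s)=\tfrac14(s^2-1)^2$. The constant $B>0$ satisfies $|f'(\xi)|\le B$ for $\xi\in[-1,1]$. Put $\mathcal N(s):=f(s)+Bs$. Grid functions $u=(u_{i,j})$ live on a uniform two-dimensional Cartesian grid of mesh size $h$ in a rectangle, with $(u,v)=\langle u,v\rangle=h^2\sum_{i,j}u_{i,j}v_{i,j}$ and $\|u\|=\|u\|_2=(u,u)^{1/2}$. Neighbor values falling outside the set of unknowns are supplied by the boundary condition: wrap-around for periodic, $0$ for homogeneous Dirichlet, the value at the adjacent grid point itself for homogeneous Neumann. $(\Delta_hu)_{i,j}=h^{-2}(u_{i+1,j}+u_{i-1,j}+u_{i,j+1}+u_{i,j-1}-4u_{i,j})$, and $\nabla_h u$ is the discrete gradient of divided differences across all grid edges (including boundary edges), so that $(\nabla_hu,\nabla_hv)=-(u,\Delta_hv)$. The discrete energy is $E_h[u]=\frac{\alpha}{2}\|\nabla_hu\|^2+(F(u),1)$. Coefficients: $\beta_1=1,\ \beta_2=2,\ \beta_3=6,\ \beta_4=12$; BDF coefficients $a_{\ell,k}$: $(a_{0,1},a_{1,1})=(1,-1)$; $(a_{0,2},a_{1,2},a_{2,2})=(\tfrac32,-2,\tfrac12)$; $(a_{0,3},\dots,a_{3,3})=(\tfrac{11}{6},-3,\tfrac32,-\tfrac13)$; $(a_{0,4},\dots,a_{4,4})=(\tfrac{25}{12},-4,3,-\tfrac43,\tfrac14)$. sBDF$k$ algorithm at step $n\to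 n+1$: given $\phi^n,\dots,\phi^{n-k+1}$ with values in $[-1,1]$, set $$\mathcal H_k:=\sum_{l=1}^k\Bigl(-\beta_k a_{l,k}-\beta_k(-1)^l\tbinom{k}{l}B\Delta t\Bigr)\phi^{n+1-l},$$ $\phi^{n+1,(0)}=\phi^n$, and for $m=0,1,\dots$ $$\widetilde\phi^{\,n+1,(m+1)}_{i,j}=\frac{1}{\beta_k a_{0,k}+\frac{4\beta_k\alpha\Delta t}{h^2}+2\beta_kB\Delta t}\Bigl[(\mathcal H_k)_{i,j}+\frac{\beta_k\alpha\Delta t}{h^2}\bigl(\phi^{n+1,(m)}_{i+1,j}+\phi^{n+1,(m)}_{i-1,j}+\phi^{n+1,(m)}_{i,j+1}+\phi^{n+1,(m)}_{i,j-1}\bigr)+\beta_k\Delta t\,\mathcal N(\phi^{n+1,(m)}_{i,j})\Bigr].$$ For $k=1$, $\phi^{n+1,(m+1)}=\widetilde\phi^{\,n+1,(m+1)}$; for $k\ge 2$, $\phi^{n+1,(m+1)}=\Pi_{[-1,1]}(\widetilde\phi^{\,n+1,(m+1)})$ pointwise, where $\Pi_{[-1,1]}(s)=\max\{\min\{s,1\},-1\}$. The auxiliary quadratic functional, with $\mathcal H_k$ the history term of the step $n\to n+1$ (the same on both sides of the decay law), is $$\mathbb H_k(\phi):=\frac{a_{0,k}+B\Delta t}{2\Delta t}\Bigl\|\phi-\frac{\mathcal H_k}{\beta_ka_{0,k}+\beta_kB\Delta t}\Bigr\|_2^2 .$$ *)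

(* Defs.v *)
From mathcomp Require Import all_boot all_order all_algebra.
From mathcomp Require Import all_classical all_reals all_analysis.

Set Implicit Arguments.
Unset Strict Implicit.
Unset Printing Implicit Defensive.

Import Order.TTheory GRing.Theory Num.Theory.
Import numFieldNormedType.Exports.

Local Open Scope ring_scope.

Definition ac_f (R : realType) (s : R) : R := s - s ^+ 3.

Definition ac_F (R : realType) (s : R) : R := 4^-1 * (s ^+ 2 - 1) ^+ 2.

Definition stabN (R : realType) (B s : R) : R := ac_f s + B * s.

Inductive boundary := Periodic | Dirichlet | Neumann.

(* The unknown that supplies the value at index [i] along an axis carrying the
   unknowns 0, ..., n-1; [None] stands for the value 0. Only the indices
   -1, ..., n are ever used: clamping to [0, n-1] (Neumann) replaces a missing
   neighbour by the adjacent grid point. *)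
Definition extend (bc : boundary) (n : nat) (i : int) : option 'I_n :=
  match bc with
  | Periodic => insub `|(i %% n%:Z)%Z|%N
  | Dirichlet => if i is Posz p then insub p else None
  | Neumann => insub `|(Num.max 0 (Num.min i (n%:Z - 1)))%R|%N
  end.

Definition ext_val (R : realType) (bc : boundary) (M N : nat) (u : 'M[R]_(M, N))
    (i j : int) : R :=
  match extend bc M i, extend bc N j with
  | Some i', Some j' => u i' j'
  | _, _ => 0
  end.

Definition nbr_sum (R : realType) (bc : boundary) (M N : nat)
    (u : 'M[R]_(M, N)) (i j : int) : R :=
  ext_val bc u (i + 1) j + ext_val bc u (i - 1) j
  + ext_val bc u i (j + 1) + ext_val bc u i (j - 1).

Definition inner (R : realType) (M N : nat) (h : R) (u v : 'M[R]_(M, N)) : R :=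
  h ^+ 2 * \sum_(i < M) \sum_(j < N) u i j * v i j.

Definition norm2 (R : realType) (M N : nat) (h : R) (u : 'M[R]_(M, N)) : R :=
  Num.sqrt (inner h u u).

(* Along an axis with unknowns 0, ..., n-1, edge [e] joins the points e-1 and e.
   Edges 0 and n are the two boundary edges; in the periodic case they are the
   same edge, which is counted once. *)
Definition nb_edges (bc : boundary) (n : nat) : nat :=
  if bc is Periodic then n else n.+1.

Definition gradx (R : realType) (bc : boundary) (M N : nat) (h : R)
    (u : 'M[R]_(M, N)) : 'M[R]_(nb_edges bc M, N) :=
  \matrix_(e, j) ((ext_val bc u e%:Z j%:Z - ext_val bc u (e%:Z - 1) j%:Z) / h).

Definition grady (R : realType) (bc : boundary) (M N : nat) (h : R)
    (u : 'M[R]_(M, N)) : 'M[R]_(M, nb_edges bc N) :=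
  \matrix_(i, e) ((ext_val bc u i%:Z e%:Z - ext_val bc u i%:Z (e%:Z - 1)) / h).

Definition grad_inner (R : realType) (bc : boundary) (M N : nat) (h : R)
    (u v : 'M[R]_(M, N)) : R :=
  inner h (gradx bc h u) (gradx bc h v) + inner h (grady bc h u) (grady bc h v).

Definition grad_norm (R : realType) (bc : boundary) (M N : nat) (h : R)
    (u : 'M[R]_(M, N)) : R :=
  Num.sqrt (grad_inner bc h u u).

Definition energy (R : realType) (bc : boundary) (M N : nat) (alpha h : R)
    (u : 'M[R]_(M, N)) : R :=
  alpha / 2 * grad_norm bc h u ^+ 2 + inner h (map_mx (@ac_F R) u) (const_mx 1).

Definition beta (R : realType) (k : nat) : R :=
  match k with
  | 1 => 1 | 2 => 2 | 3 => 6 | 4 => 12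
  | _ => 0
  end.

Definition bdf (R : realType) (l k : nat) : R :=
  match k with
  | 1 => [:: 1; -1]`_l
  | 2 => [:: 3 / 2; -2; 1 / 2]`_l
  | 3 => [:: 11 / 6; -3; 3 / 2; - (1 / 3)]`_l
  | 4 => [:: 25 / 12; -4; 3; - (4 / 3); 1 / 4]`_l
  | _ => 0
  end.

Definition history (R : realType) (M N : nat) (dt B : R) (k : nat)
    (phi : nat -> 'M[R]_(M, N)) (n : nat) : 'M[R]_(M, N) :=
  \sum_(1 <= l < k.+1)
    (- (beta R k * bdf R l k)
     - beta R k * (-1) ^+ l * ('C(k, l))%:R * B * dt) *: phi (n.+1 - l)%N.

Definition proj (R : realType) (s : R) : R := Num.max (Num.min s 1) (-1).

Definition pre_step (R : realType) (bc : boundary) (M N : nat)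
    (alpha h dt B : R) (k : nat) (H u : 'M[R]_(M, N)) : 'M[R]_(M, N) :=
  \matrix_(i, j)
    ((beta R k * bdf R 0 k + 4 * beta R k * alpha * dt / h ^+ 2
      + 2 * beta R k * B * dt)^-1
     * (H i j + beta R k * alpha * dt / h ^+ 2 * nbr_sum bc u i%:Z j%:Z
        + beta R k * dt * stabN B (u i j))).

Definition step (R : realType) (bc : boundary) (M N : nat)
    (alpha h dt B : R) (k : nat) (H u : 'M[R]_(M, N)) : 'M[R]_(M, N) :=
  let v := pre_step bc alpha h dt B k H u in
  if k == 1%N then v else map_mx (@proj R) v.

Definition iterate (R : realType) (bc : boundary) (M N : nat)
    (alpha h dt B : R) (k : nat) (phi : nat -> 'M[R]_(M, N)) (n m : nat) :
    'M[R]_(M, N) :=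
  iter m (step bc alpha h dt B k (history dt B k phi n)) (phi n).

(* The history term is always that of the step n -> n+1, whatever [u] is. *)
Definition aux_energy (R : realType) (M N : nat) (h dt B : R) (k : nat)
    (phi : nat -> 'M[R]_(M, N)) (n : nat) (u : 'M[R]_(M, N)) : R :=
  (bdf R 0 k + B * dt) / (2 * dt)
  * norm2 h (u - (beta R k * bdf R 0 k + beta R k * B * dt)^-1
                 *: history dt B k phi n) ^+ 2.

Definition augmented_energy (R : realType) (bc : boundary) (M N : nat)
    (alpha h dt B : R) (k : nat) (phi : nat -> 'M[R]_(M, N)) (n m : nat) : R :=
  energy bc alpha h (iterate bc alpha h dt B k phi n m)
  + aux_energy h dt B k phi n (iterate bc alpha h dt B k phi n m).

(* Main.v *)
Require Import Defs.
From mathcomp Require Import all_boot all_order all_algebra.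
From mathcomp Require Import all_classical all_reals all_analysis.
From mathcomp Require Import ring lra zify.
Import Order.TTheory GRing.Theory Num.Theory.
Import numFieldNormedType.Exports.
Local Open Scope classical_set_scope.
Local Open Scope ring_scope.

(** Write w = v - u for one iteration u -> v, p for the iterate before
    projection, and c = a_0 + 4 alpha dt / h^2 + 2 B dt.  The fixed-point
    equation says that c (p - u) is -dt times the gradient of the augmented
    energy at u.  The remainder of the second-order expansion is at most
    (4 alpha dt / h^2 + B dt + a_0 / 2) |w|^2, because |grad_h w|^2 is at most
    (8 / h^2) |w|^2 and F'' <= B on [-1, 1].  Projection onto [-1, 1] is
    obtuse, (p - u) w >= w^2, so the energy drops by at least
    (a_0 / 2 + B dt) |w|^2.  For k = 1 the missing projection is replaced by
    the discrete maximum principle.  The decay law follows by continuity. *)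

(** * One axis: ghost values, summation by parts, spectral bound *)

Lemma extend_ord bc n (i : 'I_n) : extend bc n i%:Z = Some i.
Proof.
have ltin := ltn_ord i.
suff <- : insub (nat_of_ord i) = Some i.
  case: bc => //=.
    by rewrite modz_small // ltz_nat ltin.
  congr insub; lia.
by rewrite insubT; congr Some; apply: val_inj.
Qed.

(* The extension of [x] along an axis, with indices shifted by one: position
   [i.+1] carries [x i], positions [0] and [n.+1] carry the ghost values. *)
Definition line {R : realType} bc n (x : 'I_n -> R) (k : nat) : R :=
  oapp x 0 (extend bc n (k%:Z - 1)).

Section Line.
Variables (R : realType) (n : nat).
Implicit Types (bc : boundary) (x y : 'I_n -> R) (i : 'I_n).

Lemma line_ord bc x i : line bc n x i.+1 = x i.
Proof. by rewrite /line -natz mulrS natz addrAC subrr add0r extend_ord. Qed.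

Lemma line_periodic0 x : line Periodic n x 0 = line Periodic n x n.
Proof. by rewrite /line /= sub0r -[(- 1 %% n)%Z]modzDl. Qed.

Lemma line_periodicS x : line Periodic n x n.+1 = line Periodic n x 1.
Proof.
rewrite /line /=; have -> : n.+1%:Z - 1 = n%:Z by lia.
by rewrite modzz mod0z.
Qed.

Lemma line_dirichlet0 x : line Dirichlet n x 0 = 0.
Proof. by []. Qed.

Lemma line_dirichletS x : line Dirichlet n x n.+1 = 0.
Proof.
rewrite /line; have -> : n.+1%:Z - 1 = n%:Z by lia.
by rewrite /= insubF // ltnn.
Qed.

Lemma line_neumann0 x : line Neumann n x 0 = line Neumann n x 1.
Proof. by rewrite /line /=; congr (oapp _ _ (insub _)); lia. Qed.

Lemma line_neumannS x : line Neumann n x n.+1 = line Neumann n x n.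
Proof. by rewrite /line /=; congr (oapp _ _ (insub _)); lia. Qed.

(** Arbitrary sequences keep both boundary terms explicit, so that each boundary condition can
    dispose of them in its own way. *)
Lemma sum_by_parts (b c : nat -> R) m :
  \sum_(e < m) (b e.+1 - b e) * (c e.+1 - c e) =
  \sum_(i < m) (2 * b i.+1 - b i.+2 - b i) * c i.+1
  + (b m.+1 - b m) * c m - (b 1 - b 0) * c 0.
Proof.
elim: m => [|m IHm]; first by rewrite !big_ord0; ring.
by rewrite !big_ord_recr /= IHm; ring.
Qed.

(** Periodic: the two boundary terms cancel. Otherwise the extra edge turns the last factor [c m]
    into [c m.+1]; then the factors in [y] vanish (Dirichlet) or the boundary differences of [x] do
    (Neumann). *)
Lemma line_by_parts bc x y :
  \sum_(e < nb_edges bc n)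
    (line bc n x e.+1 - line bc n x e) * (line bc n y e.+1 - line bc n y e) =
  \sum_(i < n) (2 * x i - line bc n x i.+2 - line bc n x i) * y i.
Proof.
under [RHS]eq_bigr => i _ do rewrite -{1}(line_ord bc x) -(line_ord bc y).
case: bc => /=.
- by rewrite sum_by_parts line_periodicS !line_periodic0 addrK.
- rewrite big_ord_recr /= sum_by_parts !line_dirichletS.
  by rewrite -[RHS]addr0 -!addrA; congr (_ + _); rewrite !line_dirichlet0; ring.
- rewrite big_ord_recr /= sum_by_parts !line_neumannS.
  by rewrite -[RHS]addr0 -!addrA; congr (_ + _); rewrite !line_neumann0; ring.
Qed.

(** Both neighbour sums are shifts of the central one, so only the end terms [hb] compares
    remain. *)
Lemma sum_sqr_neighbours (b : nat -> R) m :
  b m.+1 ^+ 2 + b 0 ^+ 2 <= b 1 ^+ 2 + b m ^+ 2 ->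
  \sum_(i < m) (b i.+2 ^+ 2 + b i ^+ 2) <= 2 * \sum_(i < m) b i.+1 ^+ 2.
Proof.
move=> hb.
suff -> : \sum_(i < m) (b i.+2 ^+ 2 + b i ^+ 2) = 2 * \sum_(i < m) b i.+1 ^+ 2
   + (b m.+1 ^+ 2 + b 0 ^+ 2) - (b 1 ^+ 2 + b m ^+ 2) by lra.
elim: m {hb} => [|m IHm]; first by rewrite !big_ord0; ring.
by rewrite !big_ord_recr /= IHm; ring.
Qed.

Lemma line_quad_le bc x :
  \sum_(i < n) (2 * x i - line bc n x i.+2 - line bc n x i) * x i
  <= 4 * \sum_(i < n) x i ^+ 2.
Proof.
have hb : line bc n x n.+1 ^+ 2 + line bc n x 0 ^+ 2
          <= line bc n x 1 ^+ 2 + line bc n x n ^+ 2.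
  case: bc.
  - by rewrite line_periodicS line_periodic0.
  - by rewrite line_dirichletS line_dirichlet0 expr0n addr0 addr_ge0 ?sqr_ge0.
  - by rewrite line_neumannS line_neumann0 addrC.
have := sum_sqr_neighbours _ _ hb.
under [in X in _ <= X -> _]eq_bigr => i _ do rewrite line_ord.
set S := \sum_(i < n) x i ^+ 2 => hS.
(* Young's inequality on both products [- x i * neighbour] gives 2 + 1/2 + 1/2 = 3; the neighbour
   squares then add at most one more sum. *)
apply: (@le_trans _ _ (\sum_(i < n) (3 * x i ^+ 2
   + 2^-1 * (line bc n x i.+2 ^+ 2 + line bc n x i ^+ 2)))).
  apply: ler_sum => i _.
  have := sqr_ge0 (x i + line bc n x i.+2).
  have := sqr_ge0 (x i + line bc n x i).
  by move=> h1 h2; lra.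
by rewrite big_split /= -!mulr_sumr -/S; lra.
Qed.

End Line.

(** * Two dimensions: discrete Green identity and gradient bound *)

Section Grid.
Variables (R : realType) (bc : boundary) (M N : nat) (h : R).
Hypothesis h_gt0 : 0 < h.
Implicit Types u v w : 'M[R]_(M, N).

Let h_neq0 : h != 0. Proof. exact: lt0r_neq0. Qed.

Lemma ext_val_line_x u (e : nat) (j : 'I_N) :
  ext_val bc u (e%:Z - 1) j%:Z = line bc M (u^~ j) e.
Proof. by rewrite /ext_val /line extend_ord; case: extend. Qed.

Lemma ext_val_line_y u (i : 'I_M) (e : nat) :
  ext_val bc u i%:Z (e%:Z - 1) = line bc N (u i) e.
Proof. by rewrite /ext_val /line extend_ord; case: extend. Qed.

Lemma gradxE u e j :
  gradx bc h u e j = (line bc M (u^~ j) e.+1 - line bc M (u^~ j) e) / h.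
Proof.
rewrite mxE -!ext_val_line_x; congr ((ext_val _ _ _ _ - _) / _); lia.
Qed.

Lemma gradyE u i e :
  grady bc h u i e = (line bc N (u i) e.+1 - line bc N (u i) e) / h.
Proof.
rewrite mxE -!ext_val_line_y; congr ((ext_val _ _ _ _ - _) / _); lia.
Qed.

Lemma nbr_sumE u (i : 'I_M) (j : 'I_N) :
  nbr_sum bc u i%:Z j%:Z = line bc M (u^~ j) i.+2 + line bc M (u^~ j) i
                         + line bc N (u i) j.+2 + line bc N (u i) j.
Proof.
rewrite -!ext_val_line_x -!ext_val_line_y /nbr_sum.
have shift (k : nat) : k.+2%:Z - 1 = k%:Z + 1 by lia.
by rewrite !shift.
Qed.

Lemma inner_ge0 M' N' (u : 'M[R]_(M', N')) : 0 <= inner h u u.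
Proof.
apply: mulr_ge0; first exact: sqr_ge0.
apply: sumr_ge0 => i _; apply: sumr_ge0 => j _.
by rewrite -expr2 sqr_ge0.
Qed.

Lemma innerC M' N' (u v : 'M[R]_(M', N')) : inner h u v = inner h v u.
Proof.
by congr (_ * _); apply: eq_bigr => i _; apply: eq_bigr => j _; rewrite mulrC.
Qed.

Lemma innerDl M' N' (u v w : 'M[R]_(M', N')) :
  inner h (u + v) w = inner h u w + inner h v w.
Proof.
rewrite /inner -mulrDr -big_split; congr (_ * _); apply: eq_bigr => i _ /=.
by rewrite -big_split; apply: eq_bigr => j _ /=; rewrite mxE mulrDl.
Qed.

Lemma ext_valD u v i j :
  ext_val bc (u + v) i j = ext_val bc u i j + ext_val bc v i j.
Proof.
rewrite /ext_val; case: (extend bc M i) => [i'|]; last by rewrite addr0.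
by case: (extend bc N j) => [j'|]; rewrite ?mxE ?addr0.
Qed.

Lemma gradxD u v : gradx bc h (u + v) = gradx bc h u + gradx bc h v.
Proof. by apply/matrixP => e j; rewrite !mxE !ext_valD; ring. Qed.

Lemma gradyD u v : grady bc h (u + v) = grady bc h u + grady bc h v.
Proof. by apply/matrixP => e j; rewrite !mxE !ext_valD; ring. Qed.

Lemma grad_inner_ge0 u : 0 <= grad_inner bc h u u.
Proof. by rewrite addr_ge0 ?inner_ge0. Qed.

Lemma grad_inner_sqrD u w : grad_inner bc h (u + w) (u + w) =
  grad_inner bc h u u + 2 * grad_inner bc h u w + grad_inner bc h w w.
Proof.
rewrite /grad_inner gradxD gradyD !innerDl.
rewrite ![inner h _ (_ + _)]innerC !innerDl.
by rewrite [inner h (gradx bc h w) (gradx bc h u)]innerC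
   [inner h (grady bc h w) (grady bc h u)]innerC; ring.
Qed.

Lemma inner_gradx u v : inner h (gradx bc h u) (gradx bc h v) =
  \sum_i \sum_j
    (2 * u i j - line bc M (u^~ j) i.+2 - line bc M (u^~ j) i) * v i j.
Proof.
rewrite /inner exchange_big [RHS]exchange_big mulr_sumr.
apply: eq_bigr => j _ /=; rewrite -line_by_parts mulr_sumr.
by apply: eq_bigr => e _; rewrite !gradxE; field.
Qed.

Lemma inner_grady u v : inner h (grady bc h u) (grady bc h v) =
  \sum_i \sum_j
    (2 * u i j - line bc N (u i) j.+2 - line bc N (u i) j) * v i j.
Proof.
rewrite /inner mulr_sumr.
apply: eq_bigr => i _ /=; rewrite -line_by_parts mulr_sumr.
by apply: eq_bigr => e _; rewrite !gradyE; field.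
Qed.

(** Discrete Green identity: the weight [h ^+ 2] of [inner] cancels the two divisions by [h], so the
    right side is free of [h]. *)
Lemma grad_innerE u v : grad_inner bc h u v =
  \sum_i \sum_j (4 * u i j - nbr_sum bc u i%:Z j%:Z) * v i j.
Proof.
rewrite /grad_inner inner_gradx inner_grady -big_split.
apply: eq_bigr => i _ /=; rewrite -big_split; apply: eq_bigr => j _ /=.
by rewrite nbr_sumE; ring.
Qed.

Lemma grad_inner_le w :
  grad_inner bc h w w <= 8 * \sum_i \sum_j w i j ^+ 2.
Proof.
have -> : 8 * \sum_i \sum_j w i j ^+ 2 =
  4 * \sum_i \sum_j w i j ^+ 2 + 4 * \sum_i \sum_j w i j ^+ 2 by ring.
apply: lerD.
  rewrite inner_gradx exchange_big [in leRHS]exchange_big mulr_sumr.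
  by apply: ler_sum => j _; exact: line_quad_le.
by rewrite inner_grady mulr_sumr; apply: ler_sum => i _; exact: line_quad_le.
Qed.

End Grid.

(** * Scalar inequalities at one grid point *)

Section PointwiseDecay.
Variable R : realType.

(** On [-1, 1] the derivative 1 - 3 s^2 is largest in absolute value at the endpoints, so this value
    turns the bound on f' into [2 <= B]. *)
Lemma derive1_ac_f1 : derive1 (@ac_f R) 1 = -2.
Proof.
rewrite derive1E /ac_f.
have -> : (fun s : R => s - s ^+ 3) = (id - (fun s => s ^+ 3)) by [].
by rewrite derive_val mul1r !scale1r; ring.
Qed.

Lemma ac_F_taylor_le (B u v : R) : 2 <= B -> -1 <= u <= 1 -> -1 <= v <= 1 ->
  ac_F v - ac_F u <= - ac_f u * (v - u) + B / 2 * (v - u) ^+ 2.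
Proof.
move=> hB /andP[u1 u2] /andP[v1 v2].
(* Exact expansion of the quartic; on the square [-1, 1]^2 the last coefficient is at most (3 + 2 +
   1 - 2) / 4 = 1, hence at most B / 2. *)
have -> : ac_F v - ac_F u = - ac_f u * (v - u)
    + 4^-1 * (3 * u ^+ 2 + 2 * (u * v) + v ^+ 2 - 2) * (v - u) ^+ 2.
  by rewrite /ac_F /ac_f; field.
rewrite lerD2l; apply: ler_wpM2r; first exact: sqr_ge0.
nra.
Qed.

(** [stabN B] takes the values B and -B at 1 and -1, so each difference has a linear factor; the
    cofactor is nonnegative because B >= 2. *)
Lemma stabN_le (B s : R) : 2 <= B -> -1 <= s <= 1 -> - B <= stabN B s <= B.
Proof.
move=> hB /andP[s1 s2]; rewrite /stabN /ac_f.
have e1 : B - (s - s ^+ 3 + B * s) = (1 - s) * (B - s * (1 + s)) by ring.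
have e2 : s - s ^+ 3 + B * s + B = (1 + s) * (B + s * (1 - s)) by ring.
have p1 : 0 <= (1 - s) * (B - s * (1 + s)) by apply: mulr_ge0; nra.
have p2 : 0 <= (1 + s) * (B + s * (1 - s)) by apply: mulr_ge0; nra.
by apply/andP; split; lra.
Qed.

Lemma proj_bound (s : R) : -1 <= Defs.proj s <= 1.
Proof.
rewrite /Defs.proj le_max lexx orbT /= ge_max ge_min lexx orbT /=; lra.
Qed.

(** Equality holds if [p] is not clipped; if it is, the clipped increment has the sign of [p - u]
    and is shorter. *)
Lemma proj_obtuse (p u : R) : -1 <= u <= 1 ->
  (Defs.proj p - u) ^+ 2 <= (p - u) * (Defs.proj p - u).
Proof.
move=> /andP[u1 u2]; rewrite /Defs.proj.
case: (leP p 1) => hp; first by case: (leP p (-1)) => hp'; nra.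
by case: (leP 1 (-1)) => h1; nra.
Qed.

(** Contribution of one grid point to the energy change, with [nb] the neighbour sum. The term
    [4 * alpha * (v - u) ^+ 2] stands in for the nonlocal gradient square of the increment. *)
Lemma pointwise_decay (a b alpha h dt B H nb u v : R) :
  0 < a -> 0 < b -> 0 < alpha -> 0 < h -> 0 < dt -> 2 <= B ->
  -1 <= u <= 1 -> -1 <= v <= 1 ->
  let p := (b * a + 4 * b * alpha * dt / h ^+ 2 + 2 * b * B * dt)^-1
           * (H + b * alpha * dt / h ^+ 2 * nb + b * dt * stabN B u) in
  let g := (b * a + b * B * dt)^-1 * H in
  (v - u) ^+ 2 <= (p - u) * (v - u) ->
  alpha * ((4 * u - nb) * (v - u)) + 4 * alpha * (v - u) ^+ 2
  + h ^+ 2 * (ac_F v - ac_F u)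
  + (a + B * dt) / (2 * dt) * h ^+ 2 * ((v - g) ^+ 2 - (u - g) ^+ 2) <= 0.
Proof.
move=> a0 b0 al0 h0 dt0 hB hu hv p g hp.
have B0 : 0 < B by lra.
have Bdt0 : 0 < B * dt by exact: mulr_gt0.
pose C := alpha * dt / h ^+ 2.
have C0 : 0 < C by rewrite divr_gt0 ?mulr_gt0 ?exprn_gt0.
pose c := a + 4 * C + 2 * (B * dt).
have c0 : 0 < c by rewrite /c; lra.
have h_neq0 := lt0r_neq0 h0; have b_neq0 := lt0r_neq0 b0.
have dt_neq0 := lt0r_neq0 dt0.
(* The update equation with the common factor [b] divided out; it later eliminates [H]. *)
have hc : c * p = H / b + C * nb + dt * stabN B u.
  have e : b * a + 4 * b * alpha * dt / h ^+ 2 + 2 * b * B * dt = b * c.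
    by rewrite /c /C; field.
  rewrite /p e /C; have c_neq0 := lt0r_neq0 c0.
  by clearbody c; field; rewrite h_neq0 b_neq0 c_neq0.
have aB_neq0 : a + B * dt != 0 by apply: lt0r_neq0; lra.
have hg : (a + B * dt) * g = H / b.
  by rewrite /g; field; rewrite b_neq0 -mulrA -mulrDr mulf_neq0.
have hF := ac_F_taylor_le _ _ _ hB hu hv.
have h2 : 0 < h ^+ 2 / dt by rewrite divr_gt0 ?exprn_gt0.
set w := v - u in hp hF *.
rewrite [leLHS](_ : _ = h ^+ 2 / dt * (C * (4 * u - nb) * w + 4 * C * w ^+ 2
     + dt * (ac_F v - ac_F u) + (a + B * dt) / 2 * w ^+ 2
     + w * ((a + B * dt) * u - (a + B * dt) * g)));
  last by rewrite /C /w; field; rewrite h_neq0.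
rewrite pmulr_rle0 // hg.
have hF' := ler_wpM2l (ltW dt0) hF.
have hp' := ler_wpM2l (ltW c0) hp.
have w2 := sqr_ge0 w.
have aw : 0 <= a * w ^+ 2 by rewrite mulr_ge0 // ltW.
have Bw : 0 <= B * dt * w ^+ 2 by rewrite mulr_ge0 // ltW.
have hHb : H / b = c * p - C * nb - dt * stabN B u by rewrite hc; ring.
rewrite hHb /stabN.
have ecp : c * ((p - u) * w) = c * p * w - (a + 4 * C + 2 * (B * dt)) * u * w.
  by rewrite /c; ring.
have ecw : c * w ^+ 2 = a * w ^+ 2 + 4 * (C * w ^+ 2) + 2 * (B * dt * w ^+ 2).
  by rewrite /c; ring.
rewrite ecp ecw in hp'.
set cp := c * p in hp' *; clearbody cp.
clear hHb hc ecp ecw hg hp.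
(* The bracket is at most [- (a / 2 + B * dt) * w ^+ 2], whose sign comes from [aw] and [Bw]. *)
lra.
Qed.

End PointwiseDecay.

(** * One iteration on the whole grid, for an arbitrary history term *)

Section EnergyDecay.
Variables (R : realType) (bc : boundary) (M N : nat).
Variables (alpha h dt B : R) (k : nat).
Hypotheses (alpha_gt0 : 0 < alpha) (h_gt0 : 0 < h) (dt_gt0 : 0 < dt).
Hypothesis B_ge2 : 2 <= B.
Hypothesis k_range : (1 <= k <= 4)%N.
Implicit Types u v H : 'M[R]_(M, N).

Lemma beta_gt0 : 0 < beta R k.
Proof. by move: k_range; case: k => [|[|[|[|[|?]]]]] //= _; lra. Qed.

Lemma bdf0_gt0 : 0 < bdf R 0 k.
Proof. by move: k_range; case: k => [|[|[|[|[|?]]]]] //= _; lra. Qed.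

Definition bounded1 u := forall i j, -1 <= u i j <= 1.

Let shift H : 'M[R]_(M, N) :=
  (beta R k * bdf R 0 k + beta R k * B * dt)^-1 *: H.

(** A free [H] isolates the fixed-point map from the time levels; at [H := history dt B k phi n]
    this unfolds to the augmented energy. *)
Definition total_energy H u : R := energy bc alpha h u
  + (bdf R 0 k + B * dt) / (2 * dt) * norm2 h (u - shift H) ^+ 2.

Lemma total_energyE H u : total_energy H u =
  alpha / 2 * grad_inner bc h u u
  + h ^+ 2 * \sum_i \sum_j ac_F (u i j)
  + (bdf R 0 k + B * dt) / (2 * dt)
    * (h ^+ 2 * \sum_i \sum_j (u i j - shift H i j) ^+ 2).
Proof.
rewrite /total_energy /energy /grad_norm /norm2.
rewrite !sqr_sqrtr ?inner_ge0 ?grad_inner_ge0 //.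
congr (_ + _ * _ + _ * (_ * _)); apply: eq_bigr => i _; apply: eq_bigr => j _.
  by rewrite !mxE mulr1.
by rewrite !mxE -expr2.
Qed.

Lemma total_energy_le H u v : bounded1 u -> bounded1 v ->
  (forall i j, (v i j - u i j) ^+ 2
     <= (pre_step bc alpha h dt B k H u i j - u i j) * (v i j - u i j)) ->
  total_energy H v <= total_energy H u.
Proof.
move=> hu hv hp.
have pointwise i j := pointwise_decay _ _ _ _ h dt B (H i j) _ _ _
  bdf0_gt0 beta_gt0 alpha_gt0 h_gt0 dt_gt0 B_ge2 (hu i j) (hv i j).
rewrite -subr_le0 !total_energyE.
set w := v - u.
have vE : v = u + w by rewrite /w addrC subrK.
have -> : grad_inner bc h v v = grad_inner bc h u u
    + 2 * grad_inner bc h u w + grad_inner bc h w w.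
  by rewrite vE grad_inner_sqrD.
have wE i j : w i j = v i j - u i j by rewrite !mxE.
(* Half of this bound, alpha / 2 times 8, is the coefficient [4 * alpha] below. *)
have hw := ler_wpM2l (ltW alpha_gt0) (grad_inner_le _ bc _ _ _ h_gt0 w).
pose K := (bdf R 0 k + B * dt) / (2 * dt); rewrite -/K.
suff : \sum_i \sum_j
   (alpha * ((4 * u i j - nbr_sum bc u i%:Z j%:Z) * w i j)
    + 4 * alpha * w i j ^+ 2
    + h ^+ 2 * (ac_F (v i j) - ac_F (u i j))
    + K * h ^+ 2
      * ((v i j - shift H i j) ^+ 2 - (u i j - shift H i j) ^+ 2)) <= 0.
  under eq_bigr => i _ do rewrite !big_split /= -!mulr_sumr !sumrB.
  rewrite !big_split /= -!mulr_sumr !sumrB.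
  rewrite -(grad_innerE _ bc _ _ _ h_gt0 u w); lra.
apply: sumr_le0 => i _; apply: sumr_le0 => j _.
rewrite wE; move: (hp i j); rewrite !mxE; exact: pointwise.
Qed.

Lemma nbr_sum_bound u i j : bounded1 u -> -4 <= nbr_sum bc u i j <= 4.
Proof.
move=> hu.
have hext i' j' : -1 <= ext_val bc u i' j' <= 1.
  rewrite /ext_val; case: (extend bc M i') => [a|]; last by lra.
  by case: (extend bc N j') => [b|]; [exact: hu | lra].
rewrite /nbr_sum.
have := hext (i + 1) j; have := hext (i - 1) j.
have := hext i (j + 1); have := hext i (j - 1).
move=> /andP[? ?] /andP[? ?] /andP[? ?] /andP[? ?]; apply/andP; split; lra.
Qed.

(* Discrete maximum principle: the numerator is at most the denominator in
   absolute value, as [stabN B] maps [-1, 1] into [-B, B]. *)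
Lemma pre_step1_bounded H u : (forall i j, `|H i j| <= 1 + B * dt) ->
  bounded1 u -> bounded1 (pre_step bc alpha h dt B 1 H u).
Proof.
move=> hH hu i j; rewrite mxE /= !mul1r !mulr1.
have /andP[n1 n2] := nbr_sum_bound u i%:Z j%:Z hu.
have /andP[N1 N2] := stabN_le _ _ _ B_ge2 (hu i j).
have := hH i j; rewrite ler_norml => /andP[H1 H2].
set C := alpha * dt / h ^+ 2.
have C0 : 0 < C by rewrite divr_gt0 ?mulr_gt0 ?exprn_gt0.
have B0 : 0 < B by exact: lt_le_trans B_ge2.
have Bdt0 : 0 < B * dt by exact: mulr_gt0.
have -> : 1 + 4 * alpha * dt / h ^+ 2 + 2 * B * dt = 1 + 4 * C + 2 * (B * dt).
  by rewrite /C !mulrA.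
have D0 : 0 < 1 + 4 * C + 2 * (B * dt) by lra.
set nb := nbr_sum _ _ _ _ in n1 n2 *; set s := stabN _ _ in N1 N2 *.
have Cn1 : 0 <= C * (4 + nb) by apply: mulr_ge0; lra.
have Cn2 : 0 <= C * (4 - nb) by apply: mulr_ge0; lra.
have dN1 : 0 <= dt * (B + s) by apply: mulr_ge0; [exact: ltW | lra].
have dN2 : 0 <= dt * (B - s) by apply: mulr_ge0; [exact: ltW | lra].
rewrite mulrC ler_pdivlMr // ler_pdivrMr //.
apply/andP; split; lra.
Qed.

(** For k = 1 this is the maximum principle; for other k the projection gives the bound whatever [H]
    is. *)
Lemma step_bounded H u : (k = 1%N -> forall i j, `|H i j| <= 1 + B * dt) ->
  bounded1 u -> bounded1 (step bc alpha h dt B k H u).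
Proof.
rewrite /step; case: eqP => [-> /(_ erefl) hH | _ _] hu.
  exact: pre_step1_bounded.
by move=> i j; rewrite mxE; exact: proj_bound.
Qed.

Lemma step_obtuse H u i j : bounded1 u ->
  let v := step bc alpha h dt B k H u in
  (v i j - u i j) ^+ 2
  <= (pre_step bc alpha h dt B k H u i j - u i j) * (v i j - u i j).
Proof.
rewrite /step => hu; case: eqP => _ /=; first by rewrite expr2.
by rewrite [map_mx _ _ _ _]mxE; exact: proj_obtuse.
Qed.

Lemma total_energy_step_le H u :
  (k = 1%N -> forall i j, `|H i j| <= 1 + B * dt) -> bounded1 u ->
  total_energy H (step bc alpha h dt B k H u) <= total_energy H u.
Proof.
move=> hH hu; apply: total_energy_le => //; first exact: step_bounded.
by move=> i j; exact: step_obtuse.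
Qed.

Lemma iter_step_bounded H u m :
  (k = 1%N -> forall i j, `|H i j| <= 1 + B * dt) -> bounded1 u ->
  bounded1 (iter m (step bc alpha h dt B k H) u).
Proof. by move=> hH hu; elim: m => [|m IHm] //=; exact: step_bounded. Qed.

(** * Continuity of the energy, for the passage to the limit *)

Lemma cvg_sum2 (T : Type) (F : set_system T) (FF : Filter F)
    (f : 'I_M -> 'I_N -> T -> R) (l : 'I_M -> 'I_N -> R) :
  (forall i j, f i j x @[x --> F] --> l i j) ->
  \sum_i \sum_j f i j x @[x --> F] --> \sum_i \sum_j l i j.
Proof.
move=> hf; apply: cvg_big => [|i _]; first exact: add_continuous.
by apply: cvg_big => [|j _]; [exact: add_continuous | exact: hf].
Qed.

Lemma ext_val_continuous (i j : int) :
  continuous (fun u : 'M[R]_(M, N) => ext_val bc u i j).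
Proof.
rewrite /ext_val; case: (extend bc M i) => [a|]; last exact: cst_continuous.
case: (extend bc N j) => [b|]; last exact: cst_continuous.
exact: coord_continuous.
Qed.

Lemma total_energy_continuous H : continuous (total_energy H).
Proof.
move=> u; have FF : Filter (nbhs u) by exact: nbhs_filter.
have cu i j : (fun v : 'M[R]_(M, N) => v i j) @ u --> u i j.
  exact: coord_continuous.
(* Without square roots and edge differences, the energy is a polynomial in the entries and the
   limit can be taken entrywise. *)
have -> : total_energy H = fun v : 'M[R]_(M, N) =>
  alpha / 2 * (\sum_i \sum_j (4 * v i j - nbr_sum bc v i%:Z j%:Z) * v i j)
  + h ^+ 2 * \sum_i \sum_j ac_F (v i j)
  + (bdf R 0 k + B * dt) / (2 * dt)
    * (h ^+ 2 * \sum_i \sum_j (v i j - shift H i j) ^+ 2).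
  by apply/funext => v; rewrite total_energyE (grad_innerE _ bc _ _ _ h_gt0).
apply: cvgD; first apply: cvgD.
- apply: cvgMl_tmp; apply: cvg_sum2 => i j.
  have cn : (fun v : 'M[R]_(M, N) => nbr_sum bc v i%:Z j%:Z) @ u
      --> nbr_sum bc u i%:Z j%:Z.
    by do ![apply: cvgD]; exact: ext_val_continuous.
  have c1 : (fun v : 'M[R]_(M, N) => 4 * v i j - nbr_sum bc v i%:Z j%:Z) @ u -->
      4 * u i j - nbr_sum bc u i%:Z j%:Z.
    by apply: cvgB => //; exact: cvgMl_tmp.
  exact: cvgM.
- apply: cvgMl_tmp; apply: cvg_sum2 => i j; rewrite /ac_F.
  apply: cvgMl_tmp; rewrite !expr2.
  have c2 : (fun v : 'M[R]_(M, N) => v i j * v i j - 1) @ u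
      --> u i j * u i j - 1.
    by apply: cvgB; [exact: cvgM | exact: cvg_cst].
  exact: cvgM.
- apply: cvgMl_tmp; apply: cvgMl_tmp; apply: cvg_sum2 => i j; rewrite !expr2.
  have c1 : (fun v : 'M[R]_(M, N) => v i j - shift H i j) @ u
      --> u i j - shift H i j.
    by apply: cvgB => //; exact: cvg_cst.
  exact: cvgM.
Qed.

End EnergyDecay.

Theorem theorem6p1 (R : realType) (bc : boundary) (M N : nat)
    (alpha h dt B : R) (k n : nat) (phi : nat -> 'M[R]_(M, N))
    (halpha : 0 < alpha) (hh : 0 < h) (hdt : 0 < dt) (hB : 0 < B)
    (hfB : forall xi : R, -1 <= xi <= 1 -> `|derive1 (@ac_f R) xi| <= B)
    (hk : (1 <= k <= 4)%N) (hn : (k <= n.+1)%N)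
    (hphi : forall l : nat, (1 <= l <= k)%N ->
       forall i j, -1 <= phi (n.+1 - l)%N i j <= 1) :
  (forall m : nat,
     augmented_energy bc alpha h dt B k phi n m.+1
     <= augmented_energy bc alpha h dt B k phi n m)
  /\
  (iterate bc alpha h dt B k phi n m @[m --> \oo] --> phi n.+1 ->
   energy bc alpha h (phi n.+1) + aux_energy h dt B k phi n (phi n.+1)
   <= energy bc alpha h (phi n) + aux_energy h dt B k phi n (phi n)).
Proof.
have hB2 : 2 <= B.
  have := hfB 1; rewrite derive1_ac_f1 normrN normr_nat; apply; lra.
pose H := history dt B k phi n.
have hphin : bounded1 _ _ _ (phi n).
  by move=> i j; have := hphi 1%N; rewrite subSS subn0; apply; lia.
(* For k = 1 the history is [(1 + B * dt) *: phi n], and [phi n] has entries in [-1, 1]. *)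
have hH : k = 1%N -> forall i j, `|H i j| <= 1 + B * dt.
  move=> k1 i j; rewrite /H /history k1 big_nat1 subSS subn0 mxE /=.
  rewrite expr1 bin1 !mul1r mulr1 opprK mulN1r mulNr opprK.
  have Bdt : 0 < B * dt by exact: mulr_gt0.
  rewrite normrM gtr0_norm ?ler_piMr ?ler_norml ?hphin //; lra.
have augE m : augmented_energy bc alpha h dt B k phi n m =
  total_energy R bc M N alpha h dt B k H (iterate bc alpha h dt B k phi n m).
  by [].
have decay m : augmented_energy bc alpha h dt B k phi n m.+1
     <= augmented_energy bc alpha h dt B k phi n m.
  by rewrite !augE; apply: total_energy_step_le => //; exact: iter_step_bounded.
split=> // cvg_phi.
have cvg_energy : augmented_energy bc alpha h dt B k phi n m @[m --> \oo] -->
    total_energy R bc M N alpha h dt B k H (phi n.+1).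
  apply: continuous_cvg cvg_phi.
  exact: total_energy_continuous.
have noninc : nonincreasing_seq (augmented_energy bc alpha h dt B k phi n).
  exact/nonincreasing_seqP.
(* The limit of a nonincreasing sequence is below its term 0, and iterate 0 is [phi n]. *)
have := nonincreasing_cvgn_ge noninc (cvgP _ cvg_energy) 0.
by rewrite (cvg_lim _ cvg_energy).
Qed.
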